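(* The length elements $\mathrm{ds}^2$ of the Fisher information matrix coincide under reparameterization: if $\psi$ and $\phi$ are two coordinate systems (parameterizations) of the same statistical model, related by a reparameterization, and $\Delta\psi$, $\Delta\phi$ represent the same infinitesimal displacement in the two systems, then $\mathrm{ds}^2(\psi)=\mathrm{ds}^2(\phi)$. Therefore, for the $\psi$- or $\phi$-coordinate system in which the Fisher information matrix is written as the Hessian $\nabla^2F(\psi)$, respectively $\nabla^2F^*(\phi)$, the following holds: $$\mathrm{ds}^2(\psi)=\Delta\psi^\top\,\nabla^2F(\psi)\,\Delta\psi=\Delta\phi^\top\,\nabla^2F^*(\phi)\,\Delta\phi=\mathrm{ds}^2(\phi).$$
   Context: For a parametric statistical model with parameter $\psi$ and densities $p_\psi$, the Fisher information matrix $\mathcal{I}_\psi(\psi)$ has entries $\mathbb{E}[\partial_{\psi_i}\log p_\psi(x)\,\partial_{\psi_j}\log p_\psi(x)]$. The length element in a coordinate system is the quadratic form of the Fisher information matrix on the displacement: $\mathrm{ds}^2(\psi)=\Delta\psi^\top\mathcal{I}_\psi(\psi)\Delta\psi$ and $\mathrm{ds}^2(\phi)=\Delta\phi^\top\mathcal{I}_\phi(\phi)\Delta\phi$. A reparameterization is a change of coordinates on the Riemannian manifold formed by the model with the Fisher metric (the model being assumed non-singular); displacements correspond through its differential, $\Delta\psi=J\,\Delta\phi$ with $J_{ij}=\partial\psi_i/\partial\phi_j$. In the displayed formula, $F(\psi)$ denotes the log-normalizer of an exponential family and $F^*(\phi)$ its convex conjugate (the negentropy), with $\mathcal{I}_\psi(\psi)=\nabla^2F(\psi)$,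 $\mathcal{I}_\phi(\phi)=\nabla^2F^*(\phi)$, $\psi=\nabla F^*(\phi)$, and hence $\Delta\psi=\nabla^2F^*(\phi)\,\Delta\phi$. *)

(* Defs.v *)
From HB Require Import structures.
From mathcomp Require Import all_boot all_order all_algebra.
From mathcomp Require Import all_classical all_reals all_analysis.

Set Implicit Arguments.
Unset Strict Implicit.
Unset Printing Implicit Defensive.

Import Order.TTheory GRing.Theory Num.Theory.
Import numFieldNormedType.Exports.

Local Open Scope classical_set_scope.
Local Open Scope ring_scope.

(* Coordinates are column vectors. *)

Definition dot (R : realType) (n : nat) (u v : 'cV[R]_n) : R :=
  (u^T *m v) 0 0.

Definition partial (R : realType) (n : nat) (i : 'I_n)
    (f : 'cV[R]_n -> R) (a : 'cV[R]_n) : R :=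
  'D_(delta_mx i 0) f a.

Definition gradient (R : realType) (n : nat)
    (f : 'cV[R]_n -> R) (a : 'cV[R]_n) : 'cV[R]_n :=
  \col_i partial i f a.

Definition hessian (R : realType) (n : nat)
    (f : 'cV[R]_n -> R) (a : 'cV[R]_n) : 'M[R]_n :=
  \matrix_(i, j) partial i (partial j f) a.

(* Entry (i, j) is the derivative of the i-th component of g in the j-th
   variable; the library's 'J is for row vectors and is the transpose of this. *)
Definition jacobian_cv (R : realType) (n : nat)
    (g : 'cV[R]_n -> 'cV[R]_n) (a : 'cV[R]_n) : 'M[R]_n :=
  \matrix_(i, j) partial j (fun t => g t i 0) a.

Definition quad_form (R : realType) (n : nat)
    (A : 'M[R]_n) (v : 'cV[R]_n) : R :=
  (v^T *m A *m v) 0 0.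

(* A family of densities with respect to mu is a function
   p : 'cV[R]_n -> X -> R, only meaningful on a given parameter domain. *)

(* Expectation of f under the distribution with density rho. *)
Definition expect (R : realType) (d : measure_display) (X : measurableType d)
    (mu : {measure set X -> \bar R}) (rho f : X -> R) : R :=
  \int[mu]_x (f x * rho x).

Definition score (R : realType) (n : nat) (X : Type)
    (p : 'cV[R]_n -> X -> R) (psi : 'cV[R]_n) (i : 'I_n) (x : X) : R :=
  partial i (fun t => ln (p t x)) psi.

Definition fisher (R : realType) (d : measure_display) (X : measurableType d)
    (mu : {measure set X -> \bar R}) (n : nat)
    (p : 'cV[R]_n -> X -> R) (psi : 'cV[R]_n) : 'M[R]_n :=
  \matrix_(i, j) expect mu (p psi) (fun x => score p psi i x * score p psi j x).

Definition ds2 (R : realType) (d : measure_display) (X : measurableType d)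
    (mu : {measure set X -> \bar R}) (n : nat)
    (p : 'cV[R]_n -> X -> R) (psi Dpsi : 'cV[R]_n) : R :=
  quad_form (fisher mu p psi) Dpsi.

(* Non-singular parametric model on the open parameter domain U.  The
   log-density is required to be differentiable only where the density is
   positive: other points do not contribute to the Fisher information (and the
   library sets ln 0 = 0).  The integrability condition says that the
   expectations defining the Fisher information exist. *)
Record nonsingular_model (R : realType) (d : measure_display)
    (X : measurableType d) (mu : {measure set X -> \bar R}) (n : nat)
    (U : set 'cV[R]_n) (p : 'cV[R]_n -> X -> R) : Prop := NonsingularModel {
  model_open : open U ;
  model_measurable : forall psi, U psi -> measurable_fun setT (p psi) ;
  model_ge0 : forall psi x, U psi -> 0 <= p psi x ;
  model_mass : forall psi, U psi -> (\int[mu]_x (p psi x)%:E = 1)%E ;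
  model_differentiable : forall psi x, U psi -> 0 < p psi x ->
    differentiable (fun t : 'cV[R]_n => ln (p t x)) psi ;
  model_integrable : forall psi i j, U psi ->
    mu.-integrable setT
      (fun x => (score p psi i x * score p psi j x * p psi x)%:E) ;
  model_nonsingular : forall psi, U psi -> fisher mu p psi \in unitmx
}.

(* psi = g phi is a change of coordinates from the domain V of phi onto the
   domain U of psi. *)
Record reparameterization (R : realType) (n : nat)
    (V U : set 'cV[R]_n) (g : 'cV[R]_n -> 'cV[R]_n) : Prop :=
  Reparameterization {
  reparam_open_dom : open V ;
  reparam_open_cod : open U ;
  reparam_differentiable : forall phi, V phi -> differentiable g phi ;
  reparam_inverse : exists f : 'cV[R]_n -> 'cV[R]_n,
    [/\ forall phi, V phi -> U (g phi) /\ f (g phi) = phi,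
        forall psi, U psi -> V (f psi) /\ g (f psi) = psi
      & forall psi, U psi -> differentiable f psi]
}.

(* Dpsi at g phi and Dphi at phi are the same tangent vector. *)
Definition same_displacement (R : realType) (n : nat)
    (g : 'cV[R]_n -> 'cV[R]_n) (phi Dpsi Dphi : 'cV[R]_n) : Prop :=
  Dpsi = jacobian_cv g phi *m Dphi.

(* Exponential family with base density h >= 0 with respect to mu and
   sufficient statistic T. *)

Definition partition_function (R : realType) (d : measure_display)
    (X : measurableType d) (mu : {measure set X -> \bar R}) (n : nat)
    (h : X -> R) (T : X -> 'cV[R]_n) (theta : 'cV[R]_n) : \bar R :=
  (\int[mu]_x (h x * expR (dot theta (T x)))%:E)%E.

Definition natural_space (R : realType) (d : measure_display)
    (X : measurableType d) (mu : {measure set X -> \bar R}) (n : nat)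
    (h : X -> R) (T : X -> 'cV[R]_n) : set 'cV[R]_n :=
  [set theta | (0 < partition_function mu h T theta < +oo)%E].

Definition log_normalizer (R : realType) (d : measure_display)
    (X : measurableType d) (mu : {measure set X -> \bar R}) (n : nat)
    (h : X -> R) (T : X -> 'cV[R]_n) (theta : 'cV[R]_n) : R :=
  ln (fine (partition_function mu h T theta)).

Definition exp_family (R : realType) (d : measure_display)
    (X : measurableType d) (mu : {measure set X -> \bar R}) (n : nat)
    (h : X -> R) (T : X -> 'cV[R]_n) (theta : 'cV[R]_n) (x : X) : R :=
  h x * expR (dot theta (T x) - log_normalizer mu h T theta).

(* Convex conjugate of the function equal to F on D and to +oo outside D. *)
Definition convex_conjugate (R : realType) (n : nat)
    (D : set 'cV[R]_n) (F : 'cV[R]_n -> R) (phi : 'cV[R]_n) : \bar R :=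
  ereal_sup [set (dot theta phi - F theta)%:E | theta in D].

Definition log_normalizer_conj (R : realType) (d : measure_display)
    (X : measurableType d) (mu : {measure set X -> \bar R}) (n : nat)
    (h : X -> R) (T : X -> 'cV[R]_n) : 'cV[R]_n -> \bar R :=
  convex_conjugate (natural_space mu h T) (log_normalizer mu h T).

(* Real-valued; meaningful only where log_normalizer_conj is finite. *)
Definition negentropy (R : realType) (d : measure_display)
    (X : measurableType d) (mu : {measure set X -> \bar R}) (n : nat)
    (h : X -> R) (T : X -> 'cV[R]_n) (phi : 'cV[R]_n) : R :=
  fine (log_normalizer_conj mu h T phi).

(* Main.v *)
(* Where the density is positive the chain rule expresses the score in the new
   coordinates through the Jacobian J, so that the Fisher matrices are related
   by I_phi = J^T I_psi J; this is the invariance of ds^2.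

   In an exponential family let eta(psi) be the mean of T. Integrating
   e^y >= 1 + y against the density shows that eta(psi) is a subgradient of F at
   psi, whence F*(eta(psi)) = <psi, eta(psi)> - F(psi). Convexity of F* along the
   segment from phi to eta(psi), where psi = grad F*(phi), then gives
   F(psi) + F*(phi) = <psi, phi> without the biconjugation theorem. Hence
   F = <., f> - F* o f with f the inverse of grad F*, so F is differentiable and
   grad F = f = eta. Differentiating eta under the integral sign identifies the
   Hessian of F with the covariance of T, i.e. with the Fisher matrix, and the
   chain rule for f o grad F* = id makes the two Hessians mutually inverse. *)
Require Import Defs.
From HB Require Import structures.
From mathcomp Require Import all_boot all_order all_algebra.
From mathcomp Require Import all_classical all_reals all_analysis.
From mathcomp Require Import measurable_realfun ring lra.

Import Order.TTheory GRing.Theory Num.Theory.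
Import numFieldNormedType.Exports.

Local Open Scope classical_set_scope.
Local Open Scope ring_scope.

(** * Partial derivatives and the chain rule for column vectors *)

Lemma diff_partial (R : realType) (n : nat) (f : 'cV[R]_n -> R)
    (a v : 'cV[R]_n) :
  differentiable f a -> 'd f a v = \sum_i v i 0 * partial i f a.
Proof.
move=> df; rewrite [in LHS](matrix_sum_delta v) linear_sum /=.
apply: eq_bigr => i _; rewrite big_ord1 linearZ /= /partial deriveE //.
Qed.

Lemma differentiable_component (R : realType) (n : nat)
    (g : 'cV[R]_n -> 'cV[R]_n) (a : 'cV[R]_n) (i : 'I_n) :
  differentiable g a -> differentiable (fun t => g t i 0) a.
Proof.
move=> dg; apply: (@differentiable_comp _ _ _ _ g (fun N : 'cV[R]_n => N i 0)) => //.
exact: differentiable_coord.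
Qed.

Lemma diff_jacobian_cv (R : realType) (n : nat) (g : 'cV[R]_n -> 'cV[R]_n)
    (a : 'cV[R]_n) (i j : 'I_n) :
  differentiable g a -> 'd g a (delta_mx j 0) i 0 = jacobian_cv g a i j.
Proof.
move=> dg; rewrite -deriveE // derive_mx ?mxE //.
exact: diff_derivable.
Qed.

Lemma partial_comp (R : realType) (n : nat) (g : 'cV[R]_n -> 'cV[R]_n)
    (f : 'cV[R]_n -> R) (a : 'cV[R]_n) (i : 'I_n) :
  differentiable g a -> differentiable f (g a) ->
  partial i (f \o g) a = \sum_j partial j f (g a) * jacobian_cv g a j i.
Proof.
move=> dg df; rewrite /partial deriveE; last exact: differentiable_comp.
rewrite diff_comp //= diff_partial //; apply: eq_bigr => j _.
by rewrite mulrC diff_jacobian_cv.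
Qed.

Lemma quad_form_mul (R : realType) (n : nat) (A J : 'M[R]_n) (v : 'cV[R]_n) :
  quad_form A (J *m v) = quad_form (J^T *m A *m J) v.
Proof. by rewrite /quad_form trmx_mul !mulmxA. Qed.

(** * Finite sums under the integral; symmetry of the Fisher matrix *)

Lemma integrable_Rsum (R : realType) (d : measure_display)
    (X : measurableType d) (mu : {measure set X -> \bar R}) (I : Type)
    (s : seq I) (f : I -> X -> R) :
  (forall i, mu.-integrable setT (EFin \o f i)) ->
  mu.-integrable setT (fun x => (\sum_(i <- s) f i x)%:E).
Proof.
move=> intf; under eq_fun do rewrite -sumEFin.
by apply: (@integrable_sum _ _ _ mu _ measurableT _ s xpredT
  (fun i x => (f i x)%:E)) => i _; exact: intf.
Qed.

Lemma Rintegral_sum (R : realType) (d : measure_display) (X : measurableType d)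
    (mu : {measure set X -> \bar R}) (I : Type) (s : seq I) (f : I -> X -> R) :
  (forall i, mu.-integrable setT (EFin \o f i)) ->
  \int[mu]_x (\sum_(i <- s) f i x) = \sum_(i <- s) \int[mu]_x f i x.
Proof.
move=> intf; elim: s => [|i s IH].
  rewrite big_nil; under eq_Rintegral do rewrite big_nil.
  by rewrite /Rintegral integral0.
rewrite big_cons -IH; under eq_Rintegral do rewrite big_cons.
by rewrite RintegralD //; exact: integrable_Rsum.
Qed.

Lemma tr_fisher (R : realType) (d : measure_display) (X : measurableType d)
    (mu : {measure set X -> \bar R}) (n : nat) (p : 'cV[R]_n -> X -> R)
    (psi : 'cV[R]_n) :
  (fisher mu p psi)^T = fisher mu p psi.
Proof.
apply/matrixP => i j; rewrite !mxE /expect; apply: eq_Rintegral => x _.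
by move: (score p psi i x) (score p psi j x) => a b; rewrite (mulrC a).
Qed.

(** * Transformation of the Fisher matrix under a change of coordinates *)

Section change_of_coordinates.
Context (R : realType) (d : measure_display) (X : measurableType d).
Context (mu : {measure set X -> \bar R}) (n : nat).
Variables (p q : 'cV[R]_n -> X -> R) (g : 'cV[R]_n -> 'cV[R]_n).
Variable phi : 'cV[R]_n.
Hypothesis qE : \forall t \near phi, q t = p (g t).
Hypothesis g_diff : differentiable g phi.
Hypothesis p_ge0 : forall x, 0 <= p (g phi) x.
Hypothesis p_diff : forall x, 0 < p (g phi) x ->
  differentiable (fun t => ln (p t x)) (g phi).
Hypothesis p_int : forall i j, mu.-integrable setT
  (fun x => (score p (g phi) i x * score p (g phi) j x * p (g phi) x)%:E).

(** Chain rule; since a derivative is local, it is enough that [q] agrees with [p \o g] near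
    [phi]. *)
Lemma score_comp i x : 0 < p (g phi) x ->
  score q phi i x = \sum_j score p (g phi) j x * jacobian_cv g phi j i.
Proof.
move=> px; rewrite -(@partial_comp _ _ g (fun t => ln (p t x))) //; last first.
  exact: p_diff.
rewrite /score /partial; apply: near_eq_derive.
by near=> t; rewrite /= (near qE t).
Unshelve. all: end_near. Qed.

Lemma fisher_comp :
  fisher mu q phi = (jacobian_cv g phi)^T *m fisher mu p (g phi) *m jacobian_cv g phi.
Proof.
set J := jacobian_cv g phi; set psi := g phi.
have qphi : q phi = p psi by exact: (nbhs_singleton qE).
apply/matrixP => i j; rewrite !mxE /expect qphi.
(* The sums are nested as in the unfolded product of the three matrices, so that terms match once
   the integral is moved inside. *)
transitivity (\int[mu]_x (\sum_k \sum_l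
    J l i * J k j * (score p psi l x * score p psi k x * p psi x))).
  apply: eq_Rintegral => x _.
  (* Where the density is zero nothing is known about the scores, but both integrands carry the
     density as a factor. *)
  have := p_ge0 x; rewrite le_eqVlt => /predU1P[p0|px].
    rewrite -/psi in p0; rewrite -p0 mulr0 big1 // => k _.
    by rewrite big1 // => l _; rewrite !mulr0.
  rewrite !score_comp // big_distrlr /= mulr_suml [RHS]exchange_big /=.
  apply: eq_bigr => l _; rewrite big_distrl /=; apply: eq_bigr => k _.
  rewrite -/J -/psi; move: (J l i) (J k j) (score p psi l x) (score p psi k x).
  by move: (p psi x) => r a b y z; ring.
clearbody J.
have intJ k l : mu.-integrable setT
    (EFin \o (fun x =>
      J l i * J k j * (score p psi l x * score p psi k x * p psi x))).
  exact: (@integrableZl _ _ _ mu _ measurableT (J l i * J k j) _ (p_int l k)).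
rewrite Rintegral_sum => [|k]; last first.
  exact: integrable_Rsum.
apply: eq_bigr => k _; rewrite Rintegral_sum // mxE mulr_suml.
apply: eq_bigr => l _; rewrite RintegralZl //; last exact: p_int.
rewrite !mxE /expect; ring.
Qed.

Lemma ds2_comp (Dphi Dpsi : 'cV[R]_n) : same_displacement g phi Dpsi Dphi ->
  ds2 mu p (g phi) Dpsi = ds2 mu q phi Dphi.
Proof. by move=> ->; rewrite /ds2 quad_form_mul fisher_comp. Qed.

End change_of_coordinates.

(** * Local differentiability, derivatives along lines, and subgradients *)

(** The first-order expansion of [f] at [x] is also one of [g], because the remainders agree near 0;
    uniqueness of the differential then identifies its linear part. *)
Lemma near_eq_differentiable (R : realType) (V W : normedModType R)
    (f g : V -> W) (x : V) :
  (\near x, f x = g x) -> differentiable f x -> differentiable g x.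
Proof.
move=> fg df; have fgx : f x = g x := nbhs_singleton fg.
have [df_cont fE] := (diff_locallyP x f).1 df.
have gE : g \o shift x = cst (g x) + 'd f x +o_ (0 : V) id.
  have fgy : \forall y \near (0 : V), f (y + x) = g (y + x).
    by have := fg; rewrite (near_shift (0 : V)) /= subr0.
  apply/eqaddoP => e e0; move/eqaddoP : fE => /(_ e e0) fo.
  near=> y.
  rewrite (_ : _ y = (f \o shift x - (cst (f x) + 'd f x)) y); last first.
    by rewrite !fctE /= fgx (near fgy y).
  by near: y; exact: fo.
by apply/diff_locallyP; rewrite (diff_unique df_cont gE).
Unshelve. all: end_near.
Qed.

(** Reduces directional derivatives to one real variable, where the rules for products and
    exponentials and differentiation under the integral apply. *)
Lemma derive_line (R : realType) (V : normedModType R) (f : V -> R) (x v : V) :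
  'D_v f x = 'D_1 (fun t : R => f (t *: v + x)) 0.
Proof.
rewrite /derive; set g := fun h => _ *: _; set g' := fun h => _ *: _.
suff -> : g = g' by [].
by apply/funext => t; rewrite /g /g' /= addr0 scale0r add0r [_%:A]mulr1.
Qed.

Lemma is_derive_line (R : realType) (V : normedModType R) (f : V -> R)
    (x v : V) (l : R) :
  is_derive x v f l <-> is_derive (0 : R) (1 : R) (fun t : R => f (t *: v + x)) l.
Proof.
split=> -[df dfl].
  by apply: DeriveDef; [exact: (derivable1P f x v).1|rewrite -derive_line].
by apply: DeriveDef; [exact: (derivable1P f x v).2|rewrite derive_line].
Qed.

(** Differentiability gives a two-sided limit of the difference quotients, which can then be
    computed and bounded from the right alone. *)
Lemma diff_le_of_right_slope (R : realType) (V : normedModType R) (f : V -> R)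
    (x v : V) (c : R) : differentiable f x ->
  (\forall t \near 0^'+, f (t *: v + x) - f x <= t * c) -> 'd f x v <= c.
Proof.
move=> df fc; have /cvg_dnbhs_at_right dfv : derivable f x v by exact: diff_derivable.
rewrite -deriveE //; apply: cvgr_to_le dfv _.
near=> t; have t0 : 0 < t by near: t; exact: nbhs_right_gt.
by rewrite /= /GRing.scale /= ler_pdivrMl // (near fc t).
Unshelve. all: end_near. Qed.

Lemma dotE (R : realType) (n : nat) (u v : 'cV[R]_n) :
  dot u v = \sum_i u i 0 * v i 0.
Proof. by rewrite /dot mxE; apply: eq_bigr => i _; rewrite mxE. Qed.

Lemma dotC (R : realType) (n : nat) (u v : 'cV[R]_n) : dot u v = dot v u.
Proof. by rewrite !dotE; apply: eq_bigr => i _; rewrite mulrC. Qed.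

Lemma dotDl (R : realType) (n : nat) (u v w : 'cV[R]_n) :
  dot (u + v) w = dot u w + dot v w.
Proof. by rewrite /dot linearD /= mulmxDl mxE. Qed.

Lemma dotZl (R : realType) (n : nat) (c : R) (u w : 'cV[R]_n) :
  dot (c *: u) w = c * dot u w.
Proof. by rewrite /dot linearZ /= -scalemxAl mxE. Qed.

Lemma dotBl (R : realType) (n : nat) (u v w : 'cV[R]_n) :
  dot (u - v) w = dot u w - dot v w.
Proof. by rewrite -scaleN1r dotDl dotZl mulN1r. Qed.

Lemma dot_delta (R : realType) (n : nat) (i : 'I_n) (w : 'cV[R]_n) :
  dot (delta_mx i 0) w = w i 0.
Proof. by rewrite /dot trmx_delta -rowE !mxE. Qed.

Lemma diff_dot_gradient (R : realType) (n : nat) (f : 'cV[R]_n -> R)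
    (a v : 'cV[R]_n) :
  differentiable f a -> 'd f a v = dot v (gradient f a).
Proof.
move=> df; rewrite diff_partial // dotE.
by apply: eq_bigr => i _; rewrite mxE.
Qed.

(** Moving from [a] along a ray in direction v bounds <v, c> by the differential at v; using v and
    -v turns the bound into an equality. *)
Lemma gradient_of_subgradient (R : realType) (n : nat) (f : 'cV[R]_n -> R)
    (a c : 'cV[R]_n) : differentiable f a ->
  (\forall t \near a, f a + dot (t - a) c <= f t) -> gradient f a = c.
Proof.
move=> df fc.
have le_d v : dot v c <= 'd f a v.
  suff : 'd (- f) a v <= - dot v c by rewrite diffN // lerN2.
  apply: diff_le_of_right_slope; first exact: differentiableN.
  have tv : t *: v + a @[t --> (0 : R)^'+] --> a.
    rewrite -[X in _ --> X]add0r -(scale0r v); apply: cvgD; last exact: cvg_cst.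
    by apply: cvg_at_right_filter; apply: cvgZ; [exact: cvg_id|exact: cvg_cst].
  near=> t.
  have : f a + dot (t *: v + a - a) c <= f (t *: v + a).
    by near: t; exact: tv fc.
  by rewrite addrK dotZl !fctE; lra.
apply/colP => i; rewrite mxE /partial deriveE //; apply/eqP; rewrite eq_le.
have := le_d (delta_mx i 0); rewrite dot_delta => ->; rewrite andbT.
have := le_d (- delta_mx i 0); rewrite linearN /=.
by rewrite -scaleN1r dotZl dot_delta mulN1r lerN2.
Unshelve. all: end_near. Qed.

(** * Differentiating the integral of an exponentially tilted weight *)

Section exponential_tilt.
Context (R : realType) (d : measure_display) (X : measurableType d).
Context (mu : {measure set X -> \bar R}).
Variables (w a b : X -> R) (r : R).
Hypothesis w_ge0 : forall x, 0 <= w x.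
Hypothesis mw : measurable_fun setT w.
Hypothesis ma : measurable_fun setT a.
Hypothesis mb : measurable_fun setT b.
Hypothesis r_gt0 : 0 < r.
Hypothesis tilt_int : forall e1 e2 : bool, mu.-integrable setT
  (fun x => (w x * expR ((-1) ^+ e1 * (2 * r) * a x + (-1) ^+ e2 * r * b x))%:E).

(* w * S is the sum of the four weights in tilt_int; since y <= e^y, it
   dominates a^k b^l w e^(t a) up to a power of r, uniformly in |t| <= r. *)
Let S x := (expR (2 * r * a x) + expR (- (2 * r * a x))) *
           (expR (r * b x) + expR (- (r * b x))).

Let wS_int : mu.-integrable setT (fun x => (w x * S x)%:E).
Proof.
have -> : (fun x => (w x * S x)%:E) = (fun x => \sum_(e : bool * bool)
    (w x * expR ((-1) ^+ e.1 * (2 * r) * a x + (-1) ^+ e.2 * r * b x))%:E)%E.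
  apply/funext => x; rewrite sumEFin -mulr_sumr; congr (_ * _)%:E.
  rewrite -(pair_bigA _ (fun e1 e2 : bool =>
    expR ((-1) ^+ e1 * (2 * r) * a x + (-1) ^+ e2 * r * b x))) /=.
  by rewrite !big_bool /= /S !expr1 !expr0 !mulNr !mul1r !expRD; ring.
by apply: (@integrable_sum _ _ _ mu _ measurableT _ _ xpredT
  (fun (e : bool * bool) x => (w x * expR ((-1) ^+ e.1 * (2 * r) * a x +
     (-1) ^+ e.2 * r * b x))%:E)).
Qed.

Let expR_norm_le (y : R) : expR `|y| <= expR y + expR (- y).
Proof.
by case: (ger0P y) => y0; rewrite ?lerDl ?lerDr expR_ge0.
Qed.

(** The exponent 2r|a| is spent in two halves: one absorbs the tilt [t * a x], the other the factor
    [a x ^+ k]. The exponent r|b| absorbs [b x ^+ l]. *)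
Let tilt_bound k l (t : R) x : (k <= 1)%N -> (l <= 1)%N -> `|t| <= r ->
  `|a x ^+ k * b x ^+ l * w x * expR (t * a x)| <= r ^- (k + l) * (w x * S x).
Proof.
move=> k1 l1 tr.
have pow_le (m : nat) (y : R) : (m <= 1)%N -> (r * `|y|) ^+ m <= expR (r * `|y|).
  case: m => [|[|//]] _; last first.
    by rewrite expr1; apply: le_trans (expR_ge1Dx _); rewrite lerDr.
  by rewrite expr0 -expR0 ler_expR mulr_ge0 // ltW.
rewrite !normrM !normrX (ger0_norm (w_ge0 x)) (ger0_norm (expR_ge0 _)).
(* Multiplying by r^(k+l) attaches one r to each factor |a| and |b|, as [pow_le] requires. *)
rewrite -(ler_pM2l (exprn_gt0 (k + l) r_gt0)) [leRHS]mulrA mulfV ?mul1r; last first.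
  by rewrite expf_neq0 // gt_eqF.
have -> : r ^+ (k + l) * (`|a x| ^+ k * `|b x| ^+ l * w x * expR (t * a x)) =
    w x * (((r * `|a x|) ^+ k * expR (t * a x)) * (r * `|b x|) ^+ l).
  by rewrite exprD !exprMn; ring.
apply: ler_wpM2l => //; apply: ler_pM.
- by rewrite mulr_ge0 ?expR_ge0 // exprn_ge0 // mulr_ge0 // ltW.
- by rewrite exprn_ge0 // mulr_ge0 // ltW.
- apply: (@le_trans _ _ (expR (r * `|a x|) * expR (r * `|a x|))).
    apply: ler_pM; rewrite ?expR_ge0 ?pow_le //.
      by rewrite exprn_ge0 // mulr_ge0 // ltW.
    rewrite ler_expR; apply: le_trans (ler_norm _) _.
    by rewrite normrM ler_wpM2r.
  rewrite -expRD; apply: le_trans (expR_norm_le _).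
  by rewrite ler_expR !normrM (ger0_norm (ltW r_gt0)) (ger0_norm (ler0n _ 2)); lra.
- apply: le_trans (pow_le _ _ l1) _; apply: le_trans (expR_norm_le _).
  by rewrite ler_expR normrM (ger0_norm (ltW r_gt0)).
Qed.

Lemma integrable_tilt k l (t : R) : (k <= 1)%N -> (l <= 1)%N -> `|t| <= r ->
  mu.-integrable setT
    (fun x => (a x ^+ k * b x ^+ l * w x * expR (t * a x))%:E).
Proof.
move=> k1 l1 tr.
apply: (@le_integrable _ _ _ mu _ measurableT _
  (fun x => ((r ^- (k + l))%:E * (w x * S x)%:E)%E)); last first.
- exact: integrableZl.
- move=> x _; rewrite -EFinM !abse_EFin lee_fin.
  by rewrite (le_trans (tilt_bound _ _ _ x k1 l1 tr)) // ler_norm.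
apply/measurable_EFinP; repeat apply: measurable_funM => //.
- exact: measurable_funX.
- exact: measurable_funX.
- by apply: measurableT_comp => //; exact: measurable_funM.
Qed.

(** Dominated differentiation on ]-r, r[: the t-derivative of the integrand is the case k = l = 1 of
    [tilt_bound], whose bound does not depend on t. *)
Lemma is_derive_tilt :
  is_derive (0 : R) (1 : R) (fun t : R => \int[mu]_x (b x * w x * expR (t * a x)))
    (\int[mu]_x (a x * b x * w x)).
Proof.
pose f (t : R) x := b x * w x * expR (t * a x).
(* The exponents 1 are kept so that the derivative has the shape of [tilt_bound]. *)
have df t x : is_derive t (1 : R) (f ^~ x)
      (a x ^+ 1 * b x ^+ 1 * w x * expR (t * a x)).
  rewrite /f; apply: is_derive_eq; rewrite /GRing.scale /=; ring.
have dfE t x : partial1of2 f t x = a x ^+ 1 * b x ^+ 1 * w x * expR (t * a x).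
  by rewrite partial1of2E derive_val.
have I0 : `]- r, r[%classic (0 : R) by rewrite /= in_itv /= oppr_lt0 r_gt0.
have Ir t : `]- r, r[%classic t -> `|t| <= r.
  by rewrite /= in_itv /= ler_norml => /andP[/ltW -> /ltW ->].
have f_int t : `]- r, r[%classic t -> mu.-integrable setT (EFin \o f t).
  move=> /Ir tr; have := @integrable_tilt 0 1 t isT isT tr.
  by under eq_fun do rewrite expr0 expr1 mul1r.
have f_der t x : `]- r, r[%classic t -> setT x -> derivable (f ^~ x) t 1.
  by move=> _ _; exact: ex_derive.
have G_ge0 x : 0 <= r ^- 2 * (w x * S x).
  apply: mulr_ge0; first by rewrite invr_ge0 exprn_ge0 // ltW.
  by rewrite mulr_ge0 // mulr_ge0 // addr_ge0 ?expR_ge0.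
have G_int : mu.-integrable setT (EFin \o (fun x => r ^- 2 * (w x * S x))).
  exact: (@integrableZl _ _ _ mu _ measurableT (r ^- 2) _ wS_int).
have G_ub t x : `]- r, r[%classic t -> setT x ->
    `|partial1of2 f t x| <= r ^- 2 * (w x * S x).
  by move=> /Ir tr _; rewrite dfE; exact: tilt_bound.
apply: DeriveDef.
  exact: (derivable_under_integral measurableT I0 f_int f_der G_ge0 G_int G_ub).
rewrite -derive1E.
rewrite (differentiation_under_integral measurableT I0 f_int f_der G_ge0 G_int G_ub).
by apply: eq_Rintegral => x _; rewrite dfE mul0r expR0 mulr1 !expr1.
Qed.

End exponential_tilt.

(** * Convex conjugates: attainment of the supremum and the tangent inequality *)

Lemma convex_conjugate_ge (R : realType) (n : nat) (D : set 'cV[R]_n)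
    (F : 'cV[R]_n -> R) (theta phi : 'cV[R]_n) :
  D theta -> ((dot theta phi - F theta)%:E <= convex_conjugate D F phi)%E.
Proof. by move=> Dtheta; apply: ereal_sup_ubound; exists theta. Qed.

(** A subgradient [eta] at [theta] means that t |-> <t, eta> - F t is largest at [theta], so the
    supremum is attained there. *)
Lemma convex_conjugate_subgradient (R : realType) (n : nat) (D : set 'cV[R]_n)
    (F : 'cV[R]_n -> R) (eta theta : 'cV[R]_n) : D theta ->
  (forall t, D t -> F theta + dot (t - theta) eta <= F t) ->
  convex_conjugate D F eta = (dot theta eta - F theta)%:E.
Proof.
move=> Dtheta Fge; apply/eqP; rewrite eq_le convex_conjugate_ge // andbT.
apply: ub_ereal_sup => _ [t Dt <-]; rewrite lee_fin.
by have := Fge _ Dt; rewrite dotBl; lra.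
Qed.

(** A conjugate is a supremum of affine functions, hence convex, and so lies above its tangent at
    [phi]. *)
Lemma convex_conjugate_gradient_le (R : realType) (n : nat)
    (D : set 'cV[R]_n) (F : 'cV[R]_n -> R) (phi eta : 'cV[R]_n) :
  let Fs := fine \o convex_conjugate D F in
  (\forall t \near phi, convex_conjugate D F t \is a fin_num) ->
  convex_conjugate D F eta \is a fin_num ->
  differentiable Fs phi ->
  dot (eta - phi) (gradient Fs phi) <= Fs eta - Fs phi.
Proof.
move=> Fs Ffin Feta dFs; rewrite -diff_dot_gradient //.
have Fphi := nbhs_singleton Ffin.
apply: diff_le_of_right_slope => //.
have tv : t *: (eta - phi) + phi @[t --> (0 : R)^'+] --> phi.
  rewrite -[X in _ --> X]add0r -(scale0r (eta - phi)).
  apply: cvgD; last exact: cvg_cst.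
  by apply: cvg_at_right_filter; apply: cvgZ; [exact: cvg_id|exact: cvg_cst].
(* The conjugate is known to be finite only near [phi] and at [eta]; for small t > 0 the
   intermediate point lies in that neighbourhood. *)
near=> t.
have t0 : 0 <= t by apply/ltW; near: t; exact: nbhs_right_gt.
have t1 : t <= 1 by near: t; exact: nbhs_right_le.
have Ft : convex_conjugate D F (t *: (eta - phi) + phi) \is a fin_num.
  by near: t; exact: tv Ffin.
suff : (convex_conjugate D F (t *: (eta - phi) + phi) <=
    ((1 - t) * Fs phi + t * Fs eta)%:E)%E.
  rewrite -(fineK Ft) lee_fin => le_mix.
  have {le_mix} : Fs (t *: (eta - phi) + phi) <=
    (1 - t) * Fs phi + t * Fs eta := le_mix.
  by rewrite mulrBl mul1r mulrBr; lra.
(* Each affine function in the supremum interpolates exactly along the segment and is bounded by the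
   conjugate at both ends. *)
apply: ub_ereal_sup => _ [s Ds <-]; rewrite lee_fin.
have sphi : dot s phi - F s <= Fs phi.
  by rewrite -lee_fin /Fs /= fineK //; exact: convex_conjugate_ge.
have seta : dot s eta - F s <= Fs eta.
  by rewrite -lee_fin /Fs /= fineK //; exact: convex_conjugate_ge.
rewrite (dotC _ _ s) dotDl dotZl dotBl -!(dotC _ _ s).
have := ler_wpM2l t0 seta.
have t1' : 0 <= 1 - t by rewrite subr_ge0.
have := ler_wpM2l t1' sphi.
lra.
Unshelve. all: end_near. Qed.

(** * Derivatives of linear functionals *)

Lemma differentiable_dot (R : realType) (n : nat) (w a : 'cV[R]_n) :
  differentiable (fun t => dot t w) a.
Proof.
have -> : (fun t => dot t w) = \sum_(i < n) (fun t : 'cV[R]_n => t i 0 * w i 0).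
  by apply/funext => t; rewrite fct_sumE dotE.
apply: differentiable_sum => i; apply: differentiableM => //.
exact: differentiable_coord.
Qed.

Lemma partial_dot (R : realType) (n : nat) (w a : 'cV[R]_n) (i : 'I_n) :
  partial i (fun t => dot t w) a = w i 0.
Proof.
rewrite /partial derive_line.
under eq_fun do rewrite dotDl dotZl dot_delta.
by rewrite derive_val /GRing.scale /=; ring.
Qed.

(** * Exponential families: normalization and mass *)

Section exponential_family.
Context (R : realType) (d : measure_display) (X : measurableType d).
Context (mu : {measure set X -> \bar R}) (n : nat).
Variables (h : X -> R) (T : X -> 'cV[R]_n).
Hypothesis mh : measurable_fun setT h.
Hypothesis h_ge0 : forall x, 0 <= h x.
Hypothesis mT : forall i, measurable_fun setT (fun x => T x i 0).

Local Notation D := (natural_space mu h T).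
Local Notation F := (log_normalizer mu h T).
Local Notation p := (exp_family mu h T).
Let W theta x := h x * expR (dot theta (T x)).

Let measurable_dot theta : measurable_fun setT (fun x => dot theta (T x)).
Proof.
under eq_fun do rewrite dotE.
by apply: measurable_sum => i; exact: measurable_funM.
Qed.

Let measurable_W theta : measurable_fun setT (W theta).
Proof. by apply: measurable_funM => //; exact: measurableT_comp. Qed.

Let W_ge0 theta x : 0 <= W theta x.
Proof. by rewrite mulr_ge0 ?expR_ge0. Qed.

Lemma integrable_weight theta : D theta ->
  mu.-integrable setT (fun x => (W theta x)%:E).
Proof.
move=> /andP[_ Zoo]; apply/integrableP; split; first exact/measurable_EFinP.
by under eq_integral do rewrite abse_EFin ger0_norm //.
Qed.

(** The strict bounds in [natural_space] rule out the default values of [fine] and [ln]. *)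
Lemma expR_log_normalizer theta : D theta ->
  \int[mu]_x W theta x = expR (F theta).
Proof.
move=> /andP[Z0 Zoo]; rewrite /log_normalizer lnK //.
by rewrite posrE fine_gt0 // Z0.
Qed.

Lemma exp_familyE theta x : p theta x = expR (- F theta) * W theta x.
Proof. by rewrite /exp_family expRD /W; ring. Qed.

Lemma exp_family_ge0 theta x : 0 <= p theta x.
Proof. by rewrite exp_familyE mulr_ge0 ?expR_ge0. Qed.

Lemma integrable_exp_family theta : D theta ->
  mu.-integrable setT (fun x => (p theta x)%:E).
Proof.
move=> Dtheta; under eq_fun do rewrite exp_familyE EFinM.
by apply: integrableZl => //; exact: integrable_weight.
Qed.

Lemma exp_family_mass theta : D theta -> \int[mu]_x p theta x = 1.
Proof.
move=> Dtheta; under eq_Rintegral do rewrite exp_familyE.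
rewrite RintegralZl //; last exact: integrable_weight.
by rewrite expR_log_normalizer // -expRD addNr expR0.
Qed.

(** The expectation parameter eta, dual to the natural parameter. *)
Definition mean_stat (theta : 'cV[R]_n) : 'cV[R]_n :=
  \col_j \int[mu]_x (T x j 0 * p theta x).

(** * Moments at an interior point of the natural parameter space *)

Section interior.
Variable psi : 'cV[R]_n.
Hypothesis D_nbhs : nbhs psi D.

Let D_psi : D psi. Proof. exact: nbhs_singleton D_nbhs. Qed.

Let tilt_radius (i j : 'I_n) : exists2 r : R, 0 < r &
  forall c1 c2, `|c1| <= 2 * r -> `|c2| <= r ->
    D (c1 *: delta_mx i 0 + c2 *: delta_mx j 0 + psi).
Proof.
have [e /= e0 eD] := (nbhs_ballP _ _).1 D_nbhs.
(* The shift has norm at most r K; with r = e / 2 / K this is e / 2 < e. The summand 1 makes K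
   positive. *)
set K : R := 1 + 2 * `|delta_mx i 0 : 'cV[R]_n| + `|delta_mx j 0 : 'cV[R]_n|.
have K1 : 1 <= K by rewrite /K -addrA lerDl addr_ge0 // mulr_ge0.
have K0 : 0 < K by exact: lt_le_trans K1.
exists (e / 2 / K) => [|c1 c2 c1r c2r]; first by rewrite !divr_gt0.
apply: eD; rewrite -ball_normE /= opprD addrCA subrr addr0 normrN.
apply: (le_lt_trans (ler_normD _ _)); rewrite !normrZ.
have r0 : 0 < e / 2 / K by rewrite !divr_gt0.
apply: (@le_lt_trans _ _ (e / 2 / K * K)); last first.
  by rewrite divfK ?gt_eqF // ltr_pdivrMr // ltr_pMr // ltr1n.
have h1 := ler_wpM2r (normr_ge0 (delta_mx i 0 : 'cV[R]_n)) c1r.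
have h2 := ler_wpM2r (normr_ge0 (delta_mx j 0 : 'cV[R]_n)) c2r.
apply: le_trans (lerD h1 h2) _; rewrite /K !mulrDr.
by lra.
Qed.

(** Tilting the weight at [psi] by exponentials of the components of [T] gives the weight at a
    shifted parameter, integrable while the shift stays in [D]. *)
Let tilt_int (i j : 'I_n) (r : R) :
  (forall c1 c2, `|c1| <= 2 * r -> `|c2| <= r ->
    D (c1 *: delta_mx i 0 + c2 *: delta_mx j 0 + psi)) -> 0 < r ->
  forall e1 e2 : bool, mu.-integrable setT (fun x => (W psi x *
    expR ((-1) ^+ e1 * (2 * r) * T x i 0 + (-1) ^+ e2 * r * T x j 0))%:E).
Proof.
move=> Dr r0 e1 e2.
have := integrable_weight _ (Dr ((-1) ^+ e1 * (2 * r)) ((-1) ^+ e2 * r) _ _).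
rewrite !normrMsign (ger0_norm (ltW r0)) (ger0_norm (mulr_ge0 (ler0n _ 2) (ltW r0))).
move=> /(_ (lexx _) (lexx _)); apply: eq_integrable => // x _.
by rewrite /W !dotDl !dotZl !dot_delta expRD; congr (_%:E); ring.
Qed.

Lemma integrable_suff_stat j :
  mu.-integrable setT (fun x => (T x j 0 * W psi x)%:E).
Proof.
have [r r0 Dr] := tilt_radius j j.
have r0' : `|0 : R| <= r by rewrite normr0 ltW.
have := integrable_tilt _ _ _ _ _ _ _ _ (W_ge0 psi) (measurable_W psi)
  (mT j) (mT j) r0 (tilt_int _ _ _ Dr r0) 0 1 0 isT isT r0'.
by under eq_fun do rewrite expr0 mul1r expr1 mul0r expR0 mulr1.
Qed.

Lemma integrable_suff_stat2 i j :
  mu.-integrable setT (fun x => (T x i 0 * T x j 0 * W psi x)%:E).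
Proof.
have [r r0 Dr] := tilt_radius i j.
have r0' : `|0 : R| <= r by rewrite normr0 ltW.
have := integrable_tilt _ _ _ _ _ _ _ _ (W_ge0 psi) (measurable_W psi)
  (mT i) (mT j) r0 (tilt_int _ _ _ Dr r0) 1 1 0 isT isT r0'.
by under eq_fun do rewrite !expr1 mul0r expR0 mulr1.
Qed.

(** Along the line through [psi] in direction e_i the weight acquires the factor exp(t T_i), which
    is a tilt with a = T_i and b = T_j. *)
Lemma is_derive_moment i j :
  is_derive psi (delta_mx i 0) (fun t => \int[mu]_x (T x j 0 * W t x))
    (\int[mu]_x (T x i 0 * T x j 0 * W psi x)).
Proof.
have [r r0 Dr] := tilt_radius i j.
have := is_derive_tilt _ _ _ _ _ _ _ _ (W_ge0 psi) (measurable_W psi)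
  (mT i) (mT j) r0 (tilt_int _ _ _ Dr r0).
move=> dW; apply/is_derive_line.
rewrite (_ : (fun t : R => _) =
  (fun t : R => \int[mu]_x (T x j 0 * W psi x * expR (t * T x i 0)))) //.
apply/funext => t; apply: eq_Rintegral => x _.
by rewrite /W dotDl dotZl dot_delta expRD; ring.
Qed.

Let integrable_mean j : mu.-integrable setT (fun x => (T x j 0 * p psi x)%:E).
Proof.
under eq_fun do rewrite exp_familyE mulrCA EFinM.
by apply: integrableZl => //; exact: integrable_suff_stat.
Qed.

Let integrable_mean2 i j :
  mu.-integrable setT (fun x => (T x i 0 * T x j 0 * p psi x)%:E).
Proof.
under eq_fun do rewrite exp_familyE mulrCA EFinM.
by apply: integrableZl => //; exact: integrable_suff_stat2.
Qed.

Lemma log_normalizer_subgradient theta : D theta ->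
  F psi + dot (theta - psi) (mean_stat psi) <= F theta.
Proof.
(* The density at [theta] is that at [psi] times e^y with y = <v, T> - F theta + F psi, and [c] is
   the part of 1 + y independent of x. Integration turns e^y >= 1 + y into 1 >= c + <v, eta>, which
   is the claim. *)
move=> Dtheta; set v := theta - psi; set c := 1 - F theta + F psi.
pose m i x := v i 0 * (T x i 0 * p psi x).
have m_int i : mu.-integrable setT (EFin \o m i).
  exact: (@integrableZl _ _ _ mu _ measurableT (v i 0) _ (integrable_mean i)).
have cp_int : mu.-integrable setT (EFin \o (fun x => c * p psi x)).
  exact: (@integrableZl _ _ _ mu _ measurableT c _ (integrable_exp_family _ D_psi)).
have sum_int := integrable_Rsum _ _ _ mu _ (index_enum 'I_n) _ m_int.
suff : \int[mu]_x (c * p psi x + \sum_i m i x) <= \int[mu]_x p theta x.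
  rewrite exp_family_mass // RintegralD // RintegralZl //; last first.
    exact: integrable_exp_family.
  rewrite exp_family_mass // Rintegral_sum //.
  have -> : \sum_i \int[mu]_x m i x = dot v (mean_stat psi).
    rewrite dotE; apply: eq_bigr => i _; rewrite /m [mean_stat _ _ _]mxE.
    by rewrite RintegralZl //; exact: integrable_mean.
  rewrite mulr1 /c; move: (dot _ _) (F psi) (F theta) => y a b; lra.
apply: le_Rintegral => //.
- have := integrableD measurableT cp_int sum_int.
  by apply: eq_integrable => // x _; rewrite /= EFinD.
- exact: integrable_exp_family.
move=> x _.
have -> : p theta x = p psi x * expR (dot v (T x) - F theta + F psi).
  rewrite /exp_family -mulrA -expRD /v dotBl; congr (_ * expR _).
  by move: (F psi) (F theta) => a b; ring.
rewrite [leLHS](_ : _ = p psi x * (1 + (dot v (T x) - F theta + F psi))).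
  by rewrite ler_wpM2l ?expR_ge1Dx // exp_family_ge0.
have -> : \sum_i m i x = dot v (T x) * p psi x.
  by rewrite dotE mulr_suml; apply: eq_bigr => i _; rewrite /m mulrA.
by rewrite /c; move: (p psi x) (dot _ _) (F psi) (F theta) => r y a b; ring.
Qed.

(** * Score and Fisher matrix of an exponential family *)

(** Supplied in the theorem: [F_diff] by expressing [F] through its conjugate, [F_grad] by
    uniqueness of the subgradient at a point of differentiability. *)
Hypothesis F_diff : differentiable F psi.
Hypothesis F_grad : gradient F psi = mean_stat psi.

(** Positivity of the density depends on [h x] alone, so the logarithm splits for all parameters at
    once. *)
Let logE x : 0 < h x ->
  (fun t => ln (p t x)) = (fun t => ln (h x) + (dot t (T x) - F t)).
Proof.
by move=> hx; apply/funext => t; rewrite lnM ?posrE ?expR_gt0 // expRK.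
Qed.

Let h_gt0 x : 0 < p psi x -> 0 < h x.
Proof. by rewrite pmulr_lgt0 ?expR_gt0. Qed.

Lemma differentiable_log_exp_family x : 0 < p psi x ->
  differentiable (fun t => ln (p t x)) psi.
Proof.
move=> /h_gt0/logE ->; apply: differentiableD => //.
by apply: differentiableB => //; exact: differentiable_dot.
Qed.

Let score_exp_family i x : 0 < p psi x ->
  score p psi i x = T x i 0 - mean_stat psi i 0.
Proof.
move=> /h_gt0/logE logE'.
have d1 : is_derive psi (delta_mx i 0) (fun t => dot t (T x)) (T x i 0).
  apply: DeriveDef; last exact: partial_dot.
  by apply: diff_derivable; exact: differentiable_dot.
have d2 : is_derive psi (delta_mx i 0) F (mean_stat psi i 0).
  apply: DeriveDef; first exact: diff_derivable.
  by rewrite -F_grad mxE.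
have := is_deriveD (is_derive_cst (ln (h x)) psi _) (is_deriveB d1 d2).
by rewrite add0r => /@derive_val; rewrite /score /partial logE'.
Qed.

Let score2E i j x : score p psi i x * score p psi j x * p psi x =
  (T x i 0 - mean_stat psi i 0) * (T x j 0 - mean_stat psi j 0) * p psi x.
Proof.
have := exp_family_ge0 psi x.
rewrite le_eqVlt => /predU1P[<-|px]; first by rewrite !mulr0.
by rewrite !score_exp_family.
Qed.

Let cov_split i j x :
  (T x i 0 - mean_stat psi i 0) * (T x j 0 - mean_stat psi j 0) * p psi x =
  T x i 0 * T x j 0 * p psi x - mean_stat psi j 0 * (T x i 0 * p psi x)
  - mean_stat psi i 0 * (T x j 0 * p psi x)
  + mean_stat psi i 0 * mean_stat psi j 0 * p psi x.
Proof. by move: (mean_stat psi) (p psi x) => m r; ring. Qed.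

Lemma integrable_score2 i j : mu.-integrable setT
  (fun x => (score p psi i x * score p psi j x * p psi x)%:E).
Proof.
under eq_fun do rewrite score2E cov_split EFinD EFinB EFinB !EFinM.
apply: integrableD => //; last first.
  under eq_fun do rewrite -EFinM.
  by apply: integrableZl => //; exact: integrable_exp_family.
apply: integrableB => //; last first.
  under eq_fun do rewrite -[(_ * (p _ _)%:E)%E]EFinM.
  by apply: integrableZl => //; exact: integrable_mean.
apply: integrableB => //; first by exact: integrable_mean2.
under eq_fun do rewrite -[(_ * (p _ _)%:E)%E]EFinM.
by apply: integrableZl => //; exact: integrable_mean.
Qed.

(** The score is the centred statistic, so this is a covariance; as the mass is 1, the last three
    terms of [cov_split] combine into one negative product of means. *)
Lemma fisher_exp_family i j : fisher mu p psi i j =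
  \int[mu]_x (T x i 0 * T x j 0 * p psi x)
  - mean_stat psi i 0 * mean_stat psi j 0.
Proof.
rewrite mxE /expect; under eq_Rintegral do rewrite score2E cov_split.
have i1 := integrable_mean2 i j.
have i2 (k l : 'I_n) : mu.-integrable setT
    (EFin \o (fun x => mean_stat psi k 0 * (T x l 0 * p psi x))).
  exact: (@integrableZl _ _ _ mu _ measurableT (mean_stat psi k 0) _
    (integrable_mean l)).
have i3 : mu.-integrable setT
    (EFin \o (fun x => mean_stat psi i 0 * mean_stat psi j 0 * p psi x)).
  exact: (@integrableZl _ _ _ mu _ measurableT
    (mean_stat psi i 0 * mean_stat psi j 0) _ (integrable_exp_family _ D_psi)).
have i12 := integrableB measurableT i1 (i2 j i).
have i123 := integrableB measurableT i12 (i2 i j).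
rewrite RintegralD // RintegralB // RintegralB //.
rewrite !(RintegralZl _ measurableT (integrable_mean _)).
rewrite (RintegralZl _ measurableT (integrable_exp_family _ D_psi)).
have mE k : \int[mu]_x (T x k 0 * p psi x) = mean_stat psi k 0 by rewrite mxE.
rewrite exp_family_mass // !mE.
by move: (mean_stat psi) (\int[mu]_x _) => m r; ring.
Qed.

End interior.

(** Product rule for eta_j = e^(-F) M: the moment contributes the second moment of T, the factor
    e^(-F) contributes -eta_i eta_j, and together they form the covariance. *)
Lemma partial_mean_stat psi i j : nbhs psi D -> differentiable F psi ->
  gradient F psi = mean_stat psi ->
  partial i (fun t => mean_stat t j 0) psi = fisher mu p psi i j.
Proof.
move=> Dpsi F_diff F_grad; pose M t := \int[mu]_x (T x j 0 * W t x).
have meanE k t : nbhs t D ->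
    mean_stat t k 0 = expR (- F t) * \int[mu]_x (T x k 0 * W t x).
  move=> Dt; rewrite mxE -RintegralZl //; last exact: integrable_suff_stat.
  by apply: eq_Rintegral => x _; rewrite exp_familyE mulrCA.
have nearM : \forall t \near psi, mean_stat t j 0 = expR (- F t) * M t.
  (* [meanE] asks for a whole neighbourhood of t in [D], so t ranges over the interior. *)
  by apply: filterS (nbhs_interior Dpsi) => t; exact: meanE.
rewrite /partial (near_eq_derive _ nearM).
have dF : is_derive psi (delta_mx i 0) F (mean_stat psi i 0).
  apply: DeriveDef; first exact: diff_derivable.
  by rewrite -F_grad mxE.
have /is_derive_line dMl := is_derive_moment _ Dpsi i j.
have /is_derive_line dFl := dF.
rewrite derive_line.
pose g s := F (s *: delta_mx i 0 + psi).
pose m s := M (s *: delta_mx i 0 + psi).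
rewrite -/(g _) -/(m _).
have dg : is_derive (0 : R) (1 : R) g (mean_stat psi i 0) := dFl.
have dm : is_derive (0 : R) (1 : R) m _ := dMl.
rewrite [LHS](_ : _ = 'D_1 (fun s : R => expR (- g s) * m s) 0) //.
rewrite derive_val.
have -> : g 0 = F psi by rewrite /g scale0r add0r.
have -> : m 0 = M psi by rewrite /m scale0r add0r.
rewrite fisher_exp_family //.
have -> : \int[mu]_x (T x i 0 * T x j 0 * p psi x) =
    expR (- F psi) * \int[mu]_x (T x i 0 * T x j 0 * W psi x).
  rewrite -RintegralZl //; last exact: integrable_suff_stat2.
  by apply: eq_Rintegral => x _; rewrite exp_familyE mulrCA.
rewrite (meanE j) // -/(M psi) /GRing.scale /=.
move: (mean_stat psi) (F psi) (M psi) (\int[mu]_x _) => a b c e; ring.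
Qed.

End exponential_family.

(** * Invariance of the length element and Legendre duality of the two Hessians *)

Theorem theorem4p2 (R : realType) (d : measure_display) (X : measurableType d)
    (mu : {measure set X -> \bar R}) (n : nat) :
  (forall (U V : set 'cV[R]_n) (p q : 'cV[R]_n -> X -> R)
      (g : 'cV[R]_n -> 'cV[R]_n),
    nonsingular_model mu U p ->
    reparameterization V U g ->
    (forall phi, V phi -> q phi = p (g phi)) ->
    forall phi Dpsi Dphi : 'cV[R]_n, V phi ->
      same_displacement g phi Dpsi Dphi ->
      ds2 mu p (g phi) Dpsi = ds2 mu q phi Dphi)
  /\
  (forall (h : X -> R) (T : X -> 'cV[R]_n) (U V : set 'cV[R]_n)
      (q : 'cV[R]_n -> X -> R),
    let p := exp_family mu h T in
    let F := log_normalizer mu h T in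
    let Fstar := negentropy mu h T in
    measurable_fun setT h ->
    (forall x, 0 <= h x) ->
    (forall i, measurable_fun setT (fun x => T x i 0)) ->
    U `<=` natural_space mu h T ->
    (forall phi, V phi -> log_normalizer_conj mu h T phi \is a fin_num) ->
    (forall phi, V phi -> differentiable Fstar phi) ->
    reparameterization V U (gradient Fstar) ->
    (forall phi, V phi -> q phi = p (gradient Fstar phi)) ->
    forall psi phi Dpsi Dphi : 'cV[R]_n, V phi ->
      psi = gradient Fstar phi ->
      same_displacement (gradient Fstar) phi Dpsi Dphi ->
      [/\ ds2 mu p psi Dpsi = quad_form (hessian F psi) Dpsi,
          quad_form (hessian F psi) Dpsi = quad_form (hessian Fstar phi) Dphi
        & quad_form (hessian Fstar phi) Dphi = ds2 mu q phi Dphi]).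
Proof.
split.
  move=> U V p q g [_ _ p_ge0 _ p_diff p_int _] [oV _ g_diff [f [gU _ _]]] qE.
  move=> phi Dpsi Dphi Vphi.
  have [Upsi _] := gU _ Vphi.
  apply: ds2_comp.
  - by apply: filterS qE _; exact: open_nbhs_nbhs.
  - exact: g_diff.
  - by move=> x; exact: p_ge0.
  - by move=> x; exact: p_diff.
  - by move=> i j; exact: p_int.
move=> h T U V q p F Fs mh h_ge0 mT UD V_fin Fs_diff.
move=> [oV oU g_diff [f [gU fV f_diff]]] qE psi phi Dpsi Dphi Vphi psiE disp.
set D := natural_space mu h T in UD.
set g := gradient Fs in g_diff gU fV qE psiE disp.
have U_nbhs t : U t -> nbhs t U by move=> Ut; exact: open_nbhs_nbhs.
have V_nbhs t : V t -> nbhs t V by move=> Vt; exact: open_nbhs_nbhs.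
have D_nbhs t : U t -> nbhs t D by move=> /U_nbhs; exact: filterS.
have fenchel_young t s : D t -> V s -> dot t s - F t <= Fs s.
  move=> Dt Vs; rewrite -lee_fin /Fs /negentropy fineK; last exact: V_fin.
  exact: convex_conjugate_ge.
have fenchel_le s : V s -> F (g s) + Fs s <= dot (g s) s.
  move=> Vs; have [Ut _] := gU _ Vs.
  have Dt := D_nbhs _ Ut.
  (* [eta] is not known to lie in [V], so finiteness of the conjugate there is read off its explicit
     value. *)
  set eta := mean_stat _ _ _ mu _ h T (g s).
  have conj_eta : convex_conjugate D F eta = (dot (g s) eta - F (g s))%:E.
    apply: convex_conjugate_subgradient => [|t]; first exact: UD.
    exact: log_normalizer_subgradient.
  have Feta_fin : convex_conjugate D F eta \is a fin_num by rewrite conj_eta.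
  have : dot (eta - s) (g s) <= fine (convex_conjugate D F eta) - Fs s.
    apply: convex_conjugate_gradient_le => //; last exact: Fs_diff.
    exact: filterS V_fin (V_nbhs _ Vs).
  (* The term <g s, eta> occurs on both sides of the tangent inequality and cancels. *)
  rewrite conj_eta dotBl (dotC _ _ s) (dotC _ _ eta) /=.
  by move: (F _) (Fs _) (dot _ _) (dot _ _) => a b c e; lra.
have fenchel s : V s -> F (g s) = dot (g s) s - Fs s.
  move=> Vs; apply/eqP; rewrite eq_le lerBrDr fenchel_le //=.
  by rewrite lerBlDl addrC -lerBlDl fenchel_young //; apply: UD; case: (gU _ Vs).
have F_diff t : U t -> differentiable F t.
  move=> Ut; apply: (@near_eq_differentiable _ _ _ (fun t => dot t (f t) - Fs (f t))).
    apply: filterS (U_nbhs _ Ut) => s Us.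
    by have [Vs gfs] := fV _ Us; rewrite -[in RHS]gfs fenchel // gfs.
  apply: differentiableB.
    rewrite (_ : (fun t => dot t (f t)) =
        \sum_(i < n) (fun t : 'cV[R]_n => t i 0 * f t i 0)).
      apply: differentiable_sum => i; apply: differentiableM.
        exact: differentiable_coord.
      by apply: differentiable_component; exact: f_diff.
    by apply/funext => s; rewrite fct_sumE dotE.
  apply: (@differentiable_comp _ _ _ _ f Fs); first exact: f_diff.
  by apply: Fs_diff; case: (fV _ Ut).
have grad_f t : U t -> gradient F t = f t.
  (* The Fenchel inequality at s and equality at t, both against [f t], say that [f t] is a
     subgradient of [F] at t. *)
  move=> Ut; apply: gradient_of_subgradient; first exact: F_diff.
  apply: filterS (D_nbhs _ Ut) => s Ds; have [Vft gft] := fV _ Ut.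
  have := fenchel_young _ _ Ds Vft; have := fenchel _ Vft; rewrite gft dotBl.
  move: (F s) (F t) (Fs _) (dot _ _) (dot _ _) => a b c e k; lra.
have grad_mean t : U t -> gradient F t = mean_stat _ _ _ mu _ h T t.
  move=> Ut; apply: gradient_of_subgradient; first exact: F_diff.
  apply: filterS (D_nbhs _ Ut); apply: log_normalizer_subgradient => //.
  exact: D_nbhs.
have [Upsi fpsi] : U psi /\ f psi = phi by rewrite psiE; exact: gU.
have hess_fisher : hessian F psi = fisher mu p psi.
  apply/matrixP => i j; rewrite mxE.
  rewrite -(partial_mean_stat _ _ _ mu _ h T mh h_ge0 mT psi i j (D_nbhs _ Upsi)
    (F_diff _ Upsi) (grad_mean _ Upsi)).
  apply: near_eq_derive; apply: filterS (U_nbhs _ Upsi) => t Ut.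
  by rewrite -grad_mean // mxE.
(* The Hessian puts the outer derivative in the row index, the Jacobian puts it in the column index;
   hence the transpose. *)
have hess_jac : hessian F psi = (jacobian_cv f psi)^T.
  apply/matrixP => i j; rewrite !mxE.
  apply: near_eq_derive; apply: filterS (U_nbhs _ Upsi) => t Ut.
  by rewrite -grad_f // mxE.
have jac_inv : jacobian_cv f psi *m jacobian_cv g phi = 1%:M.
  have df i : differentiable (fun t => f t i 0) (g phi).
    by apply: differentiable_component; apply: f_diff; rewrite -psiE.
  apply/matrixP => i j; rewrite [LHS]mxE [RHS]mxE.
  transitivity (partial j ((fun t => f t i 0) \o g) phi).
    rewrite partial_comp; [|exact: g_diff|exact: df].
    by apply: eq_bigr => k _; rewrite [jacobian_cv f psi i k]mxE psiE.
  (* On [V], hence near [phi], the i-th component of [f \o g] is the coordinate functional <t,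
     e_i>. *)
  transitivity (partial j (fun t => dot t (delta_mx i 0)) phi).
    apply: near_eq_derive; apply: filterS (V_nbhs _ Vphi) => t Vt /=.
    by rewrite dotC dot_delta (gU _ Vt).2.
  by rewrite partial_dot mxE eqxx andbT eq_sym.
have hess_conj : hessian Fs phi = (jacobian_cv g phi)^T.
  apply/matrixP => i j; rewrite !mxE; congr (partial _ _ _).
  by apply/funext => t; rewrite mxE.
have e1 : ds2 mu p psi Dpsi = quad_form (hessian F psi) Dpsi by rewrite hess_fisher.
have e2 : quad_form (hessian F psi) Dpsi = quad_form (hessian Fs phi) Dphi.
  rewrite hess_conj disp quad_form_mul.
  (* Symmetry of the Hessian of [F] is inherited from the Fisher matrix. The pulled-back form then
     collapses to the transpose of the Jacobian of [g], which is the Hessian of the conjugate. *)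
  have -> : hessian F psi = jacobian_cv f psi.
    by rewrite -[RHS]trmxK -hess_jac hess_fisher tr_fisher.
  by rewrite -mulmxA jac_inv mulmx1.
have e3 : ds2 mu p psi Dpsi = ds2 mu q phi Dphi.
  rewrite psiE; apply: ds2_comp => //.
  - by apply: filterS qE _; exact: V_nbhs.
  - exact: g_diff.
  - by move=> x; exact: exp_family_ge0.
  - rewrite -psiE => x px; apply: differentiable_log_exp_family => //.
    exact: F_diff.
  - rewrite -psiE => i j; apply: integrable_score2 => //.
    + exact: D_nbhs.
    + exact: F_diff.
    + exact: grad_mean.
by split => //; rewrite -e2 -e1.
Qed.
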